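(* Let $f(x):=8x^3-6x^4-1$ for $x\in\mathbb{R}$ and define $$j(x,y,z):=\begin{pmatrix} f(x)\\ f'(x)\\ -z\,f'(x)\end{pmatrix},\qquad (x,y,z)\in\mathbb{R}^3 .$$ Then $j\in C^2(\mathbb{R}^3)^3$, $j\neq 0$ everywhere in $\mathbb{R}^3$, $\operatorname{div} j=0$ in $\mathbb{R}^3$ and $j\cdot\operatorname{curl} j=0$ in $\mathbb{R}^3$, but there exist no positive continuous function $\sigma$ on the closed strip $S:=\{(x,y,z)\in\mathbb{R}^3:0\leq x\leq 1\}$ and $C^1$ function $u$ on $S$ such that $j=\sigma\nabla u$ in $S$.
   Context: A $C^1$ function on the closed strip $S$ is a continuous function on $S$ that is $C^1$ in the interior of $S$ and whose gradient extends continuously to $S$. *)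

(* Defs.v *)
From HB Require Import structures.
From mathcomp Require Export all_boot all_order all_algebra.
From mathcomp Require Export all_classical all_reals all_analysis.

Set Implicit Arguments.
Unset Strict Implicit.
Unset Printing Implicit Defensive.

Export Order.TTheory GRing.Theory Num.Theory.
Export numFieldNormedType.Exports.

#[global] Open Scope classical_set_scope.
#[global] Open Scope ring_scope.

Definition vec3 (R : realType) (a b c : R) : 'rV[R]_3 :=
  \row_(i < 3) [:: a; b; c]`_i.

Definition component (R : realType) n m (F : 'rV[R]_n -> 'rV[R]_m) (i : 'I_m) :
  'rV[R]_n -> R := fun p => F p 0 i.

Definition pderiv (R : realType) n (i : 'I_n) (f : 'rV[R]_n -> R) :
  'rV[R]_n -> R := 'D_('e_i) f.

(* Meant for open [A]: [f] is C^k on [A], i.e. its iterated partial derivatives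
   of order at most [k] exist and are continuous on [A]. *)
Fixpoint Ck_on (R : realType) n (k : nat) (A : set 'rV[R]_n)
    (f : 'rV[R]_n -> R) : Prop :=
  {within A, continuous f} /\
  match k with
  | 0%N => True
  | k'.+1 => forall i : 'I_n,
      (forall p, A p -> derivable f p 'e_i) /\ Ck_on k' A (pderiv i f)
  end.

Definition grad (R : realType) n (f : 'rV[R]_n -> R) (p : 'rV[R]_n) :
  'rV[R]_n := \row_(i < n) pderiv i f p.

Definition divergence (R : realType) n (F : 'rV[R]_n -> 'rV[R]_n)
    (p : 'rV[R]_n) : R :=
  \sum_(i < n) pderiv i (component F i) p.

Definition curl (R : realType) (F : 'rV[R]_3 -> 'rV[R]_3) (p : 'rV[R]_3) :
  'rV[R]_3 :=
  vec3 (pderiv 1 (component F 2) p - pderiv 2 (component F 1) p)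
       (pderiv 2 (component F 0) p - pderiv 0 (component F 2) p)
       (pderiv 0 (component F 1) p - pderiv 1 (component F 0) p).

Definition dot (R : realType) n (v w : 'rV[R]_n) : R :=
  \sum_(i < n) v 0 i * w 0 i.

(* [G] is, on [S], a continuous extension of the gradient of [u] from the
   interior of [S]; when [S] is the closure of its interior, [G] is uniquely
   determined on [S] and is what "the gradient of [u] on [S]" means. Only the
   values of [u] and [G] on [S] matter. *)
Definition grad_ext (R : realType) n (S : set 'rV[R]_n) (u : 'rV[R]_n -> R)
    (G : 'rV[R]_n -> 'rV[R]_n) : Prop :=
  {within S, continuous G} /\ forall p, S° p -> G p = grad u p.

Definition C1_closed (R : realType) n (S : set 'rV[R]_n) (u : 'rV[R]_n -> R) :
  Prop :=
  [/\ {within S, continuous u}, Ck_on 1 S° u & exists G, grad_ext S u G].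

Definition f (R : realType) (x : R) : R := 8 * x ^+ 3 - 6 * x ^+ 4 - 1.

(* The coordinates (x, y, z) of [p] are [p 0 0], [p 0 1], [p 0 2]. *)
Definition j (R : realType) (p : 'rV[R]_3) : 'rV[R]_3 :=
  vec3 (f (p 0 0)) ((@f R)^`()%classic (p 0 0))
       (- p 0 2 * (@f R)^`()%classic (p 0 0)).

Definition strip (R : realType) : set 'rV[R]_3 :=
  [set p | 0 <= p 0 0 <= 1].

(* Main.v *)
Require Import Defs.
From HB Require Import structures.
From mathcomp Require Import ring lra.

Set Implicit Arguments.
Unset Strict Implicit.
Unset Printing Implicit Defensive.

(** Suppose [j = sigma grad u]. In the plane [z = 0], [u] has partial
    derivatives [f / sigma] and [f' / sigma], so it is constant along the curves
    [y = c - H(x) / 24], where [H' = 24 f / f']. The function [H] tends to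
    [+oo] at both ends of [(0, 1)], but like [1 / x] at 0 and only like
    [- ln (1 - x)] at 1. On the segment [y = z = 0], [u] takes the same value at
    two points of equal [H]-value; since [|du/dx| = |f| / sigma] lies between
    positive constants near both ends, the increments of [u] force the distances
    of such points to 0 and to 1 to be comparable, whereas the growth of [H]
    makes the distance to 1 exponentially smaller. *)

(** * Polynomial functions and their smoothness *)

(** Each constructor matches a differentiation rule, which makes the class stable under [pderiv]. *)
Inductive polynomial_fun (R : realType) n : ('rV[R]_n -> R) -> Prop :=
| PolyCst (c : R) : polynomial_fun (cst c)
| PolyCoord (i : 'I_n) : polynomial_fun (fun p => p 0 i)
| PolyAdd f g : polynomial_fun f -> polynomial_fun g -> polynomial_fun (f + g)
| PolyMul f g : polynomial_fun f -> polynomial_fun g -> polynomial_fun (f * g).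

Lemma is_derive_coord (R : realType) n (i : 'I_n) (p v : 'rV[R]_n) :
  is_derive p v (fun q : 'rV[R]_n => q 0 i) (v 0 i).
Proof.
apply: DeriveDef.
  exact/diff_derivable/differentiable_coord.
rewrite deriveE; last exact: differentiable_coord.
have lin : linear (fun q : 'rV[R]_n => q 0 i) by move=> a x y; rewrite !mxE.
(* Packaged as a linear map, the coordinate is its own differential by [diff_lin]. *)
pose l : {linear 'rV[R]_n -> R} := HB.pack (fun q : 'rV[R]_n => q 0 i)
  (GRing.isLinear.Build _ _ _ _ _ lin).
have -> : (fun q : 'rV[R]_n => q 0 i) = l by [].
rewrite diff_lin //; exact: coord_continuous.
Qed.

Lemma polynomial_fun_derivable (R : realType) n (f : 'rV[R]_n -> R) p v :
  polynomial_fun f -> derivable f p v.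
Proof.
elim=> [c|i|g h _ ? _ ?|g h _ ? _ ?].
- exact: derivable_cst.
- exact/diff_derivable/differentiable_coord.
- exact: derivableD.
- exact: derivableM.
Qed.

Lemma polynomial_fun_pderiv (R : realType) n (f : 'rV[R]_n -> R) i :
  polynomial_fun f -> polynomial_fun (pderiv i f).
Proof.
elim=> [c|k|g h pg IHg ph IHh|g h pg IHg ph IHh].
- by have -> : pderiv i (cst c) = cst 0 :> ('rV[R]_n -> R);
    [apply/funext => p; exact: derive_cst | exact: PolyCst].
- have -> : pderiv i (fun p : 'rV[R]_n => p 0 k) = cst (('e_i : 'rV[R]_n) 0 k).
    by apply/funext => p; apply: derive_val; exact: is_derive_coord.
  exact: PolyCst.
- have -> : pderiv i (g + h) = pderiv i g + pderiv i h.
    by apply/funext => p; apply: deriveD; exact: polynomial_fun_derivable.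
  exact: PolyAdd.
- have -> : pderiv i (g * h) = g * pderiv i h + h * pderiv i g.
    by apply/funext => p; apply: deriveM; exact: polynomial_fun_derivable.
  by apply: PolyAdd; exact: PolyMul.
Qed.

Lemma polynomial_fun_continuous (R : realType) n (f : 'rV[R]_n -> R) :
  polynomial_fun f -> continuous f.
Proof.
elim=> [c|i|g h _ cg _ ch|g h _ cg _ ch] p.
- exact: cst_continuous.
- exact: coord_continuous.
- by apply: continuousD; [exact: cg|exact: ch].
- by apply: continuousM; [exact: cg|exact: ch].
Qed.

(** Induction on [k] for all [f] at once, since the partial derivatives are again polynomial. *)
Lemma polynomial_fun_Ck (R : realType) n k (A : set 'rV[R]_n)
    (f : 'rV[R]_n -> R) :
  polynomial_fun f -> Ck_on k A f.
Proof.
elim: k f => [|k IHk] f pf; split=> //;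
  try exact/continuous_subspaceT/polynomial_fun_continuous.
move=> i; split=> [p _|]; first exact: polynomial_fun_derivable.
exact/IHk/polynomial_fun_pderiv.
Qed.

(** * The derivative of [f]; components, divergence and curl of [j] *)

Lemma scale_mulE (R : realType) (a b : R) : a *: b = a * b.
Proof. by []. Qed.

Lemma is_derive_f (R : realType) (x : R) :
  is_derive x 1 (@f R) (24 * x ^+ 2 * (1 - x)).
Proof.
(* Written as an algebraic expression in functions, [f] is differentiated by instance resolution. *)
have -> : @f R = 8 *: id ^+ 3 - 6 *: id ^+ 4 - cst 1.
  by apply/funext => t; rewrite !fctE.
apply: is_derive_eq; by rewrite ?fctE /= !scale_mulE; ring.
Qed.

Lemma derive1_f (R : realType) (x : R) :
  (@f R)^`()%classic x = 24 * x ^+ 2 * (1 - x).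
Proof. by rewrite derive1E; apply: derive_val; exact: is_derive_f. Qed.

Section components.
Variable R : realType.
Let X : 'rV[R]_3 -> R := fun p => p 0 0.
Let Z : 'rV[R]_3 -> R := fun p => p 0 2.

Lemma component_j0 : component (@j R) 0 = 8 *: X ^+ 3 - 6 *: X ^+ 4 - cst 1.
Proof. by apply/funext => p; rewrite !fctE /component mxE. Qed.

Lemma component_j1 : component (@j R) 1 = 24 *: (X ^+ 2 - X ^+ 3).
Proof.
apply/funext => p; rewrite !fctE /component mxE /= derive1_f /X.
by rewrite !scale_mulE; ring.
Qed.

Lemma component_j2 : component (@j R) 2 = - Z * (24 *: (X ^+ 2 - X ^+ 3)).
Proof.
apply/funext => p; rewrite !fctE /component mxE /= derive1_f /X.
by rewrite !scale_mulE /Z; ring.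
Qed.

Lemma component_j_polynomial i : polynomial_fun (component (@j R) i).
Proof.
have pX k : polynomial_fun (X ^+ k).
  elim: k => [|k IHk]; first by rewrite expr0; exact: PolyCst.
  by rewrite exprS; apply: PolyMul => //; exact: PolyCoord.
have pZ c g : polynomial_fun g -> polynomial_fun (c *: g : 'rV[R]_3 -> R).
  move=> pg; have -> : c *: g = cst c * g by [].
  by apply: PolyMul => //; exact: PolyCst.
have pN g : polynomial_fun g -> polynomial_fun (- g : 'rV[R]_3 -> R).
  by move=> pg; rewrite -scaleN1r; exact: pZ.
have pX23 : polynomial_fun (24 *: (X ^+ 2 - X ^+ 3)).
  by apply: pZ; apply: PolyAdd => //; exact: pN.
case: i => -[|[|[|//]]] i3.
- rewrite (_ : Ordinal i3 = 0); last exact: val_inj.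
  rewrite component_j0; apply: PolyAdd; last by apply: pN; exact: PolyCst.
  by apply: PolyAdd; [exact: pZ|apply: pN; exact: pZ].
- by rewrite (_ : Ordinal i3 = 1) ?component_j1; last exact: val_inj.
- rewrite (_ : Ordinal i3 = 2) ?component_j2; last exact: val_inj.
  by apply: PolyMul => //; apply: pN; exact: PolyCoord.
Qed.

Let dX (p v : 'rV[R]_3) : is_derive p v X (v 0 0).
Proof. exact: is_derive_coord. Qed.
Let dZ (p v : 'rV[R]_3) : is_derive p v Z (v 0 2).
Proof. exact: is_derive_coord. Qed.

Lemma is_derive_j0 (p v : 'rV[R]_3) :
  is_derive p v (component (@j R) 0) (24 * p 0 0 ^+ 2 * (1 - p 0 0) * v 0 0).
Proof.
rewrite component_j0; apply: is_derive_eq.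
  apply: is_deriveB.
  by apply: is_deriveB; apply: is_deriveZ; apply: is_deriveX.
by rewrite !scale_mulE /X; ring.
Qed.

Lemma is_derive_j1 (p v : 'rV[R]_3) :
  is_derive p v (component (@j R) 1)
    (24 * (2 * p 0 0 - 3 * p 0 0 ^+ 2) * v 0 0).
Proof.
rewrite component_j1; apply: is_derive_eq.
  by apply: is_deriveZ; apply: is_deriveB; apply: is_deriveX.
by rewrite !scale_mulE /X; ring.
Qed.

Lemma is_derive_j2 (p v : 'rV[R]_3) :
  is_derive p v (component (@j R) 2)
    (- (24 * p 0 0 ^+ 2 * (1 - p 0 0)) * v 0 2
     - p 0 2 * (24 * (2 * p 0 0 - 3 * p 0 0 ^+ 2)) * v 0 0).
Proof.
rewrite component_j2; apply: is_derive_eq.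
  apply: is_deriveM; first exact: is_deriveN.
  by apply: is_deriveZ; apply: is_deriveB; apply: is_deriveX.
by rewrite !fctE !scale_mulE /X /Z; ring.
Qed.

Lemma pderiv_j i (p : 'rV[R]_3) :
  [/\ pderiv i (component (@j R) 0) p =
        24 * p 0 0 ^+ 2 * (1 - p 0 0) * (i == 0)%:R,
      pderiv i (component (@j R) 1) p =
        24 * (2 * p 0 0 - 3 * p 0 0 ^+ 2) * (i == 0)%:R &
      pderiv i (component (@j R) 2) p =
        - (24 * p 0 0 ^+ 2 * (1 - p 0 0)) * (i == 2)%:R
        - p 0 2 * (24 * (2 * p 0 0 - 3 * p 0 0 ^+ 2)) * (i == 0)%:R].
Proof.
have vE k : ('e_i : 'rV[R]_3) 0 k = (i == k)%:R by rewrite mxE eqxx eq_sym.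
rewrite -!vE; split; apply: derive_val.
- exact: is_derive_j0.
- exact: is_derive_j1.
- exact: is_derive_j2.
Qed.

(** The terms are [f'], [0] and [- f']. *)
Lemma divergence_j (p : 'rV[R]_3) : divergence (@j R) p = 0.
Proof.
rewrite /divergence !big_ord_recl big_ord0.
rewrite (_ : lift 0 (lift 0 0) = 2); last exact: val_inj.
rewrite (_ : lift 0 0 = 1); last exact: val_inj.
have [-> _ _] := pderiv_j 0 p; have [_ -> _] := pderiv_j 1 p.
by have [_ _ ->] := pderiv_j 2 p; rewrite /=; ring.
Qed.

(** Here [curl j = (0, z f'', f'')], so the product is [f' z f'' - z f' f'' = 0]. *)
Lemma dot_j_curl_j (p : 'rV[R]_3) : dot (j p) (curl (@j R) p) = 0.
Proof.
rewrite /dot !big_ord_recl big_ord0 !mxE /= !derive1_f.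
have [_ -> ->] := pderiv_j 0 p; have [-> _ ->] := pderiv_j 1 p.
by have [-> -> _] := pderiv_j 2 p; rewrite /=; ring.
Qed.

(** The zeros of [f'] are 0 and 1, where [f] is -1 and 1. *)
Lemma j_neq0 (p : 'rV[R]_3) : j p <> 0.
Proof.
move=> /rowP jp0.
have := jp0 0; have := jp0 1; rewrite !mxE /= derive1_f.
move=> /eqP; rewrite !mulf_eq0 pnatr_eq0 /= orbb => /orP[/eqP->|].
  by rewrite /f; lra.
by rewrite subr_eq0 => /eqP <-; rewrite /f; lra.
Qed.

End components.

(** * Mean value theorem and chain rule along a graph *)

(** Bounding the distance to [u] treats both orders of [u] and [v] alike and makes the mean value
    point converge with [v]. *)
Lemma MVT_between (R : realType) (g dg : R -> R) (u v : R) :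
  (forall t, `|t - u| <= `|v - u| -> is_derive t 1 g (dg t)) ->
  exists2 c, `|c - u| <= `|v - u| & g v - g u = dg c * (v - u).
Proof.
move=> gE.
have gc (l r : R) : (forall t, l <= t <= r -> is_derive t 1 g (dg t)) ->
    {within `[l, r], continuous g}.
  move=> glr; apply: derivable_within_continuous => t /=.
  by rewrite in_itv /= => /glr.
case: (leP u v) => [uv|/ltW vu].
  have H t : u <= t <= v -> `|t - u| <= `|v - u|.
    by move=> /andP[? ?]; rewrite !ger0_norm ?subr_ge0 // lerD2r.
  have [|//||c cuv e] := @MVT_segment _ g dg u v.
  - by [].
  - by move=> t; rewrite in_itv /= => /andP[/ltW ? /ltW ?]; apply/gE/H/andP.
  - by apply: gc => t /H/gE.
  - by exists c => //; apply: H; move: cuv; rewrite in_itv.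
have H t : v <= t <= u -> `|t - u| <= `|v - u|.
  by move=> /andP[? ?]; rewrite !ler0_norm ?subr_le0 // lerN2 lerD2r.
have [|||c cuv e] := @MVT_segment _ g dg v u.
- by [].
- by move=> t; rewrite in_itv /= => /andP[/ltW ? /ltW ?]; apply/gE/H/andP.
- by apply: gc => t /H/gE.
- exists c; first by apply: H; move: cuv; rewrite in_itv.
  by rewrite -opprB e; ring.
Qed.

(** The increment is split into a horizontal step at ordinate [phi (h + x)] and a vertical step at
    abscissa [x], each handled by the mean value theorem. *)
Lemma is_derive_graph (R : realType) (w a b : R -> R -> R) (phi : R -> R)
    (x dphi : R) :
  (\forall q \near (x, phi x), is_derive (q.1 : R) 1 (w^~ q.2) (a q.1 q.2)) ->
  (\forall q \near (x, phi x), is_derive (q.2 : R) 1 (w q.1) (b q.1 q.2)) ->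
  {for (x, phi x), continuous (fun q : R * R => a q.1 q.2)} ->
  {for (x, phi x), continuous (fun q : R * R => b q.1 q.2)} ->
  is_derive x 1 phi dphi ->
  is_derive x 1 (fun t => w t (phi t)) (a x (phi x) + b x (phi x) * dphi).
Proof.
move=> /nbhs_ballP[ra /= ra0 wa] /nbhs_ballP[rb /= rb0 wb] ca cb phix.
have cphi : {for x, continuous phi}.
  by apply: differentiable_continuous; apply/derivable1_diffP.
have cphi0 : phi (h + x) @[h --> 0^'] --> phi x.
  have H : phi (h + x) @[h --> 0] --> phi x.
    by have := @cvg_comp_shift _ _ _ x 0 phi; rewrite add0r => ->.
  exact: cvg_within_filter H.
(* For these increments both steps stay where the partial derivatives exist. *)
pose good h := [/\ h != 0, `|h| < ra, `|phi (h + x) - phi x| < ra &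
  `|phi (h + x) - phi x| < rb].
pose quot h := h^-1 * (phi (h + x) - phi x).
(* The mean value points are chosen as functions of the increment [h], so that
   the limit follows from the continuity of [a] and [b] alone. *)
have /choice[cd Hcd] : forall h, exists cd : R * R,
    [/\ `|cd.1 - x| <= `|h|, `|cd.2 - phi x| <= `|phi (h + x) - phi x| &
    good h -> h^-1 * (w (h + x) (phi (h + x)) - w x (phi x)) =
              a cd.1 (phi (h + x)) + b x cd.2 * quot h].
  (* For a bad [h] the base point serves: its bounds are trivial and the identity is vacuous. *)
  move=> h; have [[h0 hra hphira hphirb]|ngood] := pselect (good h); last first.
    by exists (x, phi x); split => //=; rewrite subrr normr0.
  have [c cx ec] : exists2 c, `|c - x| <= `|(h + x) - x| &
      w (h + x) (phi (h + x)) - w x (phi (h + x)) =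
      a c (phi (h + x)) * ((h + x) - x).
    apply: (@MVT_between _ (w^~ (phi (h + x))) (a^~ (phi (h + x)))) => t.
    rewrite addrK => tx; apply: (wa (t, _)); split; rewrite /= /ball /=.
      by rewrite distrC (le_lt_trans tx).
    by rewrite distrC.
  have [d dx ed] : exists2 d, `|d - phi x| <= `|phi (h + x) - phi x| &
      w x (phi (h + x)) - w x (phi x) = b x d * (phi (h + x) - phi x).
    apply: MVT_between => t tx; apply: (wb (x, t)); split; rewrite /= /ball /=.
      by rewrite subrr normr0.
    by rewrite distrC (le_lt_trans tx).
  exists (c, d); split => //=; first by rewrite addrK in cx.
  move=> _; rewrite /quot; rewrite addrK in ec.
  rewrite -(subrK (w x (phi (h + x))) (w (h + x) _)) -addrA ec ed mulrDr.
  by rewrite mulrCA mulVf // mulr1 mulrCA.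
have good0 : \forall h \near 0^', good h.
  near=> h; split.
  - by near: h; exact: nbhs_dnbhs_neq.
  - by near: h; apply: dnbhs0_lt.
  - rewrite distrC; near: h; move/cvgrPdist_lt : cphi0; exact.
  - rewrite distrC; near: h; move/cvgrPdist_lt : cphi0; exact.
have quotE : quot h @[h --> 0^'] --> dphi.
  have [dphix <-] := phix.
  suff -> : quot = fun h => h^-1 *: (phi (h *: 1 + x) - phi x) by exact: dphix.
  by apply/funext => h; rewrite /quot [_ *: 1]mulr1.
have c1 : (cd h).1 @[h --> 0^'] --> x.
  apply/cvgrPdist_le => e e0; near=> h; rewrite distrC.
  have [H _ _] := Hcd h; apply: le_trans H _.
  by near: h; apply: dnbhs0_le.
have c2 : (cd h).2 @[h --> 0^'] --> phi x.
  apply/cvgrPdist_le => e e0; near=> h; rewrite distrC.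
  have [_ H _] := Hcd h; apply: le_trans H _.
  by rewrite distrC; near: h; move/cvgrPdist_le : cphi0; exact.
have lim : h^-1 *: (w (h *: 1 + x) (phi (h *: 1 + x)) - w x (phi x))
    @[h --> 0^'] --> a x (phi x) + b x (phi x) * dphi.
  have : a (cd h).1 (phi (h + x)) + b x (cd h).2 * quot h @[h --> 0^']
      --> a x (phi x) + b x (phi x) * dphi.
    apply: cvgD; last apply: cvgM => //.
      exact: continuous2_cvg ca c1 cphi0.
    exact: continuous2_cvg cb (cvg_cst _) c2.
  apply: cvg_trans; apply: near_eq_cvg; near=> h.
  have [_ _ <-] := Hcd h; first by rewrite [_ *: 1]mulr1.
  by near: h.
apply: DeriveDef; first by apply/cvg_ex; eexists; exact: lim.
exact: cvg_lim lim.
Unshelve. all: by end_near. Qed.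

(** * The function [height] and its growth at 0 and 1 *)

(* A primitive of [24 f / f'] on (0, 1), from the partial fraction expansion
   [24 f / f' = 6 x - 2 - 1 / x - 1 / x^2 + 1 / (1 - x)]. *)
Definition height (R : realType) (x : R) : R :=
  x^-1 - ln x - ln (1 - x) + 3 * x ^+ 2 - 2 * x.

(** The quotient is left as [24 f / f'] so that it cancels later against the partial derivatives of
    [u]. *)
Lemma is_derive_height (R : realType) (x : R) : 0 < x < 1 ->
  is_derive x 1 (@height R) (24 * f x / (24 * x ^+ 2 * (1 - x))).
Proof.
move=> /andP[x0 x1].
have x1' : 0 < 1 - x by rewrite subr_gt0.
have dlnx := is_derive1_ln x0.
have d1x : is_derive x 1 (fun t : R => 1 - t) (-1).
  have -> : (fun t : R => 1 - t) = cst 1 - id by [].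
  by apply: is_derive_eq; exact: sub0r.
have dln1x : is_derive x 1 (@ln R \o (fun t : R => 1 - t)) ((1 - x)^-1 * -1).
  by apply: is_derive1_comp; exact: is_derive1_ln.
have dV : is_derive x 1 (fun t : R => t^-1) (- x ^- 2 *: 1).
  by apply: (@is_deriveV _ id); rewrite gt_eqF.
have -> : @height R = (fun t : R => t^-1) - @ln R
    - (@ln R \o (fun t : R => 1 - t)) + 3 *: id ^+ 2 - 2 *: id.
  by apply/funext => t; rewrite /height !fctE /=.
apply: is_derive_eq; rewrite ?fctE /= !scale_mulE /f.
by field; rewrite !gt_eqF.
Qed.

Lemma height_continuous (R : realType) (a b : R) : 0 < a -> b < 1 ->
  {within `[a, b], continuous (@height R)}.
Proof.
move=> a0 b1; apply: derivable_within_continuous => x.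
rewrite in_itv /= => /andP[ax xb].
have x01 : 0 < x < 1 by rewrite (lt_le_trans a0) // (le_lt_trans xb).
by have [] := is_derive_height x01.
Qed.

(** Nonnegative terms are dropped and [- 2 x >= - 2]. The first bound serves near 0, the second near
    1. *)
Lemma height_ge (R : realType) (x : R) : 0 < x < 1 ->
  x^-1 - 2 <= height x /\ - ln (1 - x) - 2 <= height x.
Proof.
move=> /andP[x0 x1].
have l1 : ln x <= 0 by rewrite ln_le0 // ltW.
have l2 : ln (1 - x) <= 0 by rewrite ln_le0 // lerBlDr lerDl ltW.
have v0 : 0 < x^-1 by rewrite invr_gt0.
have s0 : 0 <= x ^+ 2 by exact: sqr_ge0.
by split; rewrite /height; lra.
Qed.

(** On this interval [1 / x <= 2], [- ln x <= ln 2 <= 1] and [3 x^2 - 2 x <= x <= 1], which add up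
    to 4. *)
Lemma height_le (R : realType) (x : R) : 2^-1 <= x < 1 ->
  height x <= 4 - ln (1 - x).
Proof.
move=> /andP[x2 x1].
have x0 : 0 < x by apply: lt_le_trans x2; rewrite invr_gt0.
have v2 : x^-1 <= 2 by rewrite -[leRHS]invrK lef_pV2 // posrE invr_gt0.
have l1 : - ln x <= 1.
  rewrite -lnV ?posrE //.
  apply: le_trans (_ : ln 2 <= _); first by rewrite ler_ln // posrE ?invr_gt0.
  by have := @le_ln1Dx R 1; rewrite (_ : 1 + 1 = 2) //; apply; lra.
have s0 : x ^+ 2 <= x by rewrite expr2 ler_piMl // ltW.
rewrite /height; lra.
Qed.

(** Intermediate values; the threshold 5 comes from [height (1/2) <= 4 + ln 2 <= 5]. *)
Lemma height_onto (R : realType) (v : R) : 5 <= v ->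
  exists2 x : R, 2^-1 <= x < 1 & height x = v.
Proof.
move=> v5.
have h2 : 2^-1 < 1 :> R by rewrite invf_lt1 // ltr1n.
have h0 : 0 < 2^-1 :> R by rewrite invr_gt0.
have hhalf : height (2^-1 : R) <= v.
  apply: le_trans (height_le _) _; first by rewrite lexx.
  rewrite (_ : 1 - 2^-1 = 2^-1); last by lra.
  rewrite lnV ?posrE // opprK.
  have := @le_ln1Dx R 1; rewrite (_ : 1 + 1 = 2) // => /(_ ltac:(lra)); lra.
(* Chosen so that the lower bound [- ln (1 - b) - 2] is exactly [v]. *)
pose b : R := 1 - expR (- (v + 2)).
have eb : expR (- (v + 2)) <= 2^-1.
  rewrite expRN lef_pV2 ?posrE ?expR_gt0 //.
  by apply: le_trans (expR_ge1Dx _); lra.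
have b1 : b < 1 by rewrite /b ltrBlDr ltrDl expR_gt0.
have hb : 2^-1 <= b by rewrite /b; lra.
have vb : v <= height b.
  have b01 : 0 < b < 1 by rewrite (lt_le_trans h0).
  apply: le_trans (height_ge b01).2.
  by rewrite /b (_ : 1 - (1 - _) = expR (- (v + 2))) ?expRK; lra.
have [||c cb <-] := @IVT R (@height R) 2^-1 b v hb.
- exact: height_continuous.
- by rewrite ge_min le_max hhalf vb orbT.
exists c => //; move: cb; rewrite in_itv /= => /andP[-> cb].
exact: le_lt_trans b1.
Qed.

(** * Estimates and the contradiction in one variable *)

(** The quadratic lower bound of the exponential suffices. The 7 later ensures [x <= 1/7] and
    [1 / x - 2 >= 5] for [x = exp (- a)]. *)
Lemma expR_gt_linear (R : realType) (C : R) :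
  exists2 a : R, 7 <= expR a & a + C < expR a.
Proof.
pose a : R := 7 + `|C|; exists a.
  by apply: le_trans (expR_ge1Dx _); rewrite /a; have := normr_ge0 C; lra.
have := @expR_ge1Dxn R a 1; rewrite /a.
have := normr_ge0 C; have := ler_norm C; set c := `|C| => Cc c0.
move=> /(_ ltac:(lra)); apply: lt_le_trans.
rewrite (_ : 2`!%:R = 2) //; nra.
Qed.

(** Here [8 x^3 <= 1/8]; this keeps [f] away from 0 near the left end. *)
Lemma f_le_small (R : realType) (x : R) : 0 <= x <= 4^-1 -> f x <= - 2^-1.
Proof.
move=> /andP[x0 x4].
have : x ^+ 3 <= 4^-1 ^+ 3 by rewrite lerXn2r // nnegrE invr_ge0.
have : 0 <= x ^+ 4 by exact: exprn_ge0.
rewrite /f; lra.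
Qed.

Lemma f_norm_le (R : realType) (x : R) : 0 <= x <= 1 -> `|f x| <= 8.
Proof.
move=> /andP[x0 x1].
have : x ^+ 4 <= x ^+ 3 by rewrite exprS ler_piMl // exprn_ge0.
have : x ^+ 3 <= 1 by rewrite exprn_ile1.
have : 0 <= x ^+ 4 by exact: exprn_ge0.
rewrite ler_norml /f => *; apply/andP; split; lra.
Qed.

(** Here [g] and [s] stand for [u] and [sigma] on the segment [y = z = 0]. Continuity of [s] up to
    both endpoints makes the speeds of [g] near 0 and near 1 comparable. *)
Lemma no_equal_values_at_equal_heights (R : realType) (g s : R -> R) :
  {within `[0, 1], continuous s} -> (forall x : R, 0 <= x <= 1 -> 0 < s x) ->
  (forall x : R, 0 < x < 1 -> is_derive x 1 g (f x / s x)) ->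
  ~ (forall x1 x2 : R, 0 < x1 < 1 -> 0 < x2 < 1 -> height x1 = height x2 ->
     g x1 = g x2).
Proof.
move=> cs s0 dg gH.
have [M M0 sM] : exists2 M, 0 < M & forall x : R, 0 <= x <= 1 -> s x <= M.
  have [c c01 cmax] := EVT_max ler01 cs.
  exists (s c); first by apply: s0; move: c01; rewrite in_itv.
  by move=> x x01; apply: cmax; rewrite in_itv.
have [m m0 ms] : exists2 m, 0 < m & forall x : R, 0 <= x <= 1 -> m <= s x.
  have [c c01 cmin] := EVT_min ler01 cs.
  exists (s c); first by apply: s0; move: c01; rewrite in_itv.
  by move=> x x01; apply: cmin; rewrite in_itv.
have gmvt a b : 0 < a -> a <= b -> b < 1 ->
    exists2 c, a <= c <= b & g b - g a = f c / s c * (b - a).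
  move=> a0 ab b1.
  have ab01 x : a <= x <= b -> 0 < x < 1.
    by move=> /andP[ax xb]; rewrite (lt_le_trans a0) // (le_lt_trans xb).
  have [|||c cab e] := @MVT_segment R g (fun x => f x / s x) a b.
  - by [].
  - move=> x; rewrite in_itv /= => /andP[/ltW ax /ltW xb].
    exact/dg/ab01/andP.
  - apply: derivable_within_continuous => x; rewrite in_itv /= => /ab01/dg.
    by case.
  - by exists c.
(* Between [x / 2] and [x], [|g'| >= (1/2) / M], over a length [x / 2]. *)
have glow x : 0 < x <= 4^-1 -> (4 * M)^-1 * x <= `|g x - g (x / 2)|.
  move=> /andP[x0 x4].
  have [|||c /andP[c1 c2] ->] := gmvt (x / 2) x; rewrite ?divr_gt0 //; try lra.
  have c01 : 0 <= c <= 1 by apply/andP; split; lra.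
  rewrite normrM (_ : x - x / 2 = x / 2); last by lra.
  rewrite (ger0_norm (_ : 0 <= x / 2)); last by lra.
  rewrite normrM normfV (ger0_norm (ltW (s0 _ c01))).
  have fc : 2^-1 <= `|f c|.
    have := @f_le_small R c; rewrite ler_normr => /(_ ltac:(lra)) fc.
    by apply/orP; right; lra.
  have -> : (4 * M)^-1 * x = 2^-1 * M^-1 * (x / 2) by rewrite invfM; lra.
  apply: ler_wpM2r; first by lra.
  apply: ler_pM => //; rewrite ?invr_ge0 ?(ltW M0) //.
  by rewrite lef_pV2 ?posrE ?s0 ?sM.
have gup a b : 0 < a < 1 -> 0 < b < 1 -> `|g b - g a| <= 8 / m * `|b - a|.
  wlog ab : a b / a <= b.
    move=> W a01 b01; have [|/ltW] := leP a b; first by move/W; apply.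
    by move=> ba; rewrite distrC (distrC b); apply: W.
  move=> /andP[a0 a1] /andP[b0 b1].
  have [c /andP[c1 c2] ->] := gmvt a b a0 ab b1.
  have c01 : 0 <= c <= 1 by apply/andP; split; lra.
  rewrite normrM ler_wpM2r // normrM normfV (ger0_norm (ltW (s0 _ c01))).
  apply: ler_pM => //; rewrite ?invr_ge0 ?(ltW (s0 _ c01)) ?f_norm_le //.
  by rewrite lef_pV2 ?posrE ?s0 ?ms.
(* Chosen so that [8 / m * K = 1 / (4 M)]: the upper bound [gup] over a length [K x] meets the lower
   bound [glow]. *)
pose K := m / (32 * M).
have K0 : 0 < K by rewrite divr_gt0 // mulr_gt0.
(* The 6 adds the constants 4 of [height_le] and 2 of [height_ge]; with [x = exp (- a)], [aC] reads
   [1 / x - 6 > - ln (K x)]. *)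
have [a a6 aC] := expR_gt_linear (6 - ln K).
pose x := (expR a)^-1.
have x0 : 0 < x by rewrite invr_gt0 expR_gt0.
have x6 : x <= 7^-1 by rewrite lef_pV2 ?posrE ?expR_gt0.
have xV : x^-1 = expR a by rewrite invrK.
have lnx : ln x = - a by rewrite lnV ?posrE ?expR_gt0 // expRK.
clearbody x.
have x01 : 0 < x < 1 by apply/andP; split => //; lra.
have x201 : 0 < x / 2 < 1 by apply/andP; split; lra.
have h1 := (height_ge x01).1.
have h2 : x^-1 - 2 <= height (x / 2).
  have v0 : 0 < x^-1 by rewrite xV expR_gt0.
  have x2V : (x / 2)^-1 = 2 * x^-1 by rewrite invfM invrK mulrC.
  have := (height_ge x201).1; rewrite x2V; lra.
(* From [1 / x - 2 <= height y <= 4 - ln (1 - y)] follows [ln (1 - y) <= 6 - 1 / x < ln (K x)]. *)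
have far y v : 2^-1 <= y < 1 -> height y = v -> x^-1 - 2 <= v -> 1 - y < K * x.
  move=> y1 <-; have := height_le y1; case/andP: y1 => y2 y1 hy hx.
  have y10 : 0 < 1 - y by lra.
  rewrite ltNge; apply/negP => Kx.
  have : ln (K * x) <= ln (1 - y) by rewrite ler_ln ?posrE // mulr_gt0.
  by rewrite lnM ?posrE // lnx => ?; lra.
(* Partners of [x] and [x / 2] at equal heights, both within [K x] of 1. *)
have [|y1 hy1 e1] := @height_onto R (height x); first by lra.
have [|y2 hy2 e2] := @height_onto R (height (x / 2)); first by lra.
have f1 := far _ _ hy1 e1 h1.
have f2 := far _ _ hy2 e2 h2.
case/andP: hy1 => a1 b1; case/andP: hy2 => a2 b2.
have y101 : 0 < y1 < 1 by apply/andP; split; lra.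
have y201 : 0 < y2 < 1 by apply/andP; split; lra.
(* The increment of [g] from [x / 2] to [x] equals the one from [y2] to [y1], which is too small. *)
have := glow x.
rewrite (gH _ _ x01 y101 (esym e1)) (gH _ _ x201 y201 (esym e2)).
move=> /(_ ltac:(lra)); apply/negP; rewrite -ltNge.
apply: le_lt_trans (gup _ _ y201 y101) _.
have d : `|y1 - y2| < K * x by rewrite ltr_norml; apply/andP; split; lra.
apply: lt_le_trans (_ : 8 / m * (K * x) <= _).
  by rewrite ltr_pM2l // divr_gt0.
rewrite /K le_eqVlt; apply/orP; left; apply/eqP; field.
by rewrite !gt_eqF.
Qed.

(** * Slices of functions on the strip *)

Section strip.
Variable R : realType.
Local Notation V := 'rV[R]_3.

Lemma vec3_shift0 (h x y z : R) :
  h *: ('e_0 : V) + vec3 x y z = vec3 (h *: 1 + x) y z.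
Proof.
apply/rowP => i; rewrite !mxE eqxx /=.
by case: i => -[|[|[|//]]] ? /=; rewrite ?scale_mulE ?mulr1 ?mulr0 ?add0r.
Qed.

Lemma vec3_shift1 (h x y z : R) :
  h *: ('e_1 : V) + vec3 x y z = vec3 x (h *: 1 + y) z.
Proof.
apply/rowP => i; rewrite !mxE eqxx /=.
by case: i => -[|[|[|//]]] ? /=; rewrite ?scale_mulE ?mulr1 ?mulr0 ?add0r.
Qed.

(** The difference quotients of the slice and of [u] along ['e_0] are the same function of [h]. *)
Lemma is_derive_vec3_0 (u : V -> R) (x y z : R) :
  derivable u (vec3 x y z) 'e_0 ->
  is_derive x 1 (fun t => u (vec3 t y z)) (pderiv 0 u (vec3 x y z)).
Proof.
have E : (fun h => h^-1 *: (((fun t => u (vec3 t y z)) \o shift x) (h *: 1) -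
      u (vec3 x y z))) =
    (fun h => h^-1 *: ((u \o shift (vec3 x y z)) (h *: 'e_0) - u (vec3 x y z))).
  by apply/funext => h /=; rewrite vec3_shift0.
by move=> du; apply: DeriveDef; rewrite /derivable /pderiv /derive E.
Qed.

Lemma is_derive_vec3_1 (u : V -> R) (x y z : R) :
  derivable u (vec3 x y z) 'e_1 ->
  is_derive y 1 (fun t => u (vec3 x t z)) (pderiv 1 u (vec3 x y z)).
Proof.
have E : (fun h => h^-1 *: (((fun t => u (vec3 x t z)) \o shift y) (h *: 1) -
      u (vec3 x y z))) =
    (fun h => h^-1 *: ((u \o shift (vec3 x y z)) (h *: 'e_1) - u (vec3 x y z))).
  by apply/funext => h /=; rewrite vec3_shift1.
by move=> du; apply: DeriveDef; rewrite /derivable /pderiv /derive E.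
Qed.

Lemma vec3_continuous (z : R) : continuous (fun q : R * R => vec3 q.1 q.2 z).
Proof.
move=> q A /nbhs_ballP[e /= e0 eA]; apply/nbhs_ballP; exists e => // t [t1 t2].
apply: eA; split=> // i k; rewrite !mxE.
case: k => -[|[|[|//]]] ? //=; exact: ballxx.
Qed.

Lemma interior_strip (p : V) : 0 < p 0 0 < 1 -> (@strip R)° p.
Proof.
move=> p01; apply: (@filterS _ (nbhs p) _ [set q : V | q 0 0 \in `]0, 1[%R]).
  by move=> q /=; rewrite in_itv => /andP[/ltW ? /ltW ?]; apply/andP.
have : nbhs (p 0 0) [set` `]0, 1[%R].
  apply: open_nbhs_nbhs; split; first exact: interval_open.
  by rewrite /= in_itv.
exact: (@coord_continuous R 1 3 0 0 p).
Qed.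

(** At the endpoints continuity is only relative to the strip, so the embedding is shown to map the
    relative filter of the segment to that of the strip. *)
Lemma within_strip_line (s : V -> R) :
  {within @strip R, continuous s} ->
  {within `[0, 1], continuous (fun x => s (vec3 x 0 0))}.
Proof.
move=> /subspace_continuousP cs; apply/subspace_continuousP => x x01.
have sx t : t \in `[0, 1]%R -> @strip R (vec3 t 0 0).
  by rewrite /strip /= mxE /= in_itv.
suff H : vec3 t 0 0 @[t --> within `[0, 1] (nbhs x)] -->
    within (@strip R) (nbhs (vec3 x 0 0)).
  exact: cvg_comp H (cs _ (sx _ x01)).
move=> A; rewrite /within /= => nA.
have c : {for x, continuous (fun t : R => vec3 t 0 0)}.
  move=> B /nbhs_ballP[e /= e0 eB]; apply/nbhs_ballP; exists e => // t xt.
  apply: eB; split=> // i l; rewrite !mxE.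
  case: l => -[|[|[|//]]] ? //=; exact: ballxx.
have := c _ nA; rewrite /= !nbhs_simpl /=.
by apply: filterS => t /= At t01; apply/At/sx.
Qed.

Lemma strip_continuous_at (s : V -> R) (p : V) :
  {within @strip R, continuous s} -> 0 < p 0 0 < 1 -> {for p, continuous s}.
Proof.
move=> /continuous_subspaceW -/(_ _ (@interior_subset _ (@strip R))).
rewrite continuous_open_subspace; last exact: open_interior.
by move=> cs p01; apply: cs; rewrite inE; exact: interior_strip.
Qed.

End strip.

(** * Nonexistence of an integrating factor *)

(** In the interior [G] is [grad u], so dividing by [sigma] yields explicit partial derivatives of
    [u], whose continuity is read off the formulas. *)
Lemma no_integrating_factor (R : realType) (sigma u : 'rV[R]_3 -> R)
    (G : 'rV[R]_3 -> 'rV[R]_3) :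
  {within @strip R, continuous sigma} ->
  (forall p, strip p -> 0 < sigma p) ->
  Ck_on 1 (@strip R)° u -> grad_ext (@strip R) u G ->
  ~ (forall p, strip p -> j p = sigma p *: G p).
Proof.
move=> cs s0 [_ du] [_ Gu] jG.
have inS (x y : R) : 0 < x < 1 -> (@strip R)° (vec3 x y 0).
  by move=> x01; apply: interior_strip; rewrite mxE.
have SS (x y : R) : 0 < x < 1 -> strip (vec3 x y 0).
  by move=> x01; apply: (@interior_subset _ (@strip R)); exact: inS.
have pu i (x y : R) : 0 < x < 1 ->
    pderiv i u (vec3 x y 0) = j (vec3 x y 0) 0 i / sigma (vec3 x y 0).
  move=> x01; rewrite (jG _ (SS _ _ x01)) (Gu _ (inS _ _ x01)) !mxE mulrC.
  rewrite mulKf //.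
  by rewrite gt_eqF // s0 //; exact: SS.
pose a (x y : R) : R := f x / sigma (vec3 x y 0).
pose b (x y : R) : R := 24 * x ^+ 2 * (1 - x) / sigma (vec3 x y 0).
have ua (x y : R) : 0 < x < 1 ->
    is_derive x 1 (fun t => u (vec3 t y 0)) (a x y).
  move=> x01; have -> : a x y = pderiv 0 u (vec3 x y 0).
    by rewrite pu // !mxE /=.
  by apply: is_derive_vec3_0; case: (du 0) => + _; apply; exact: inS.
have ub (x y : R) : 0 < x < 1 ->
    is_derive y 1 (fun t => u (vec3 x t 0)) (b x y).
  move=> x01; have -> : b x y = pderiv 1 u (vec3 x y 0).
    by rewrite pu // !mxE /= /= derive1_f.
  by apply: is_derive_vec3_1; case: (du 1) => + _; apply; exact: inS.
have csV (q : R * R) : 0 < q.1 < 1 ->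
    {for q, continuous (fun q : R * R => (sigma (vec3 q.1 q.2 0))^-1)}.
  move=> q01; apply: cvgV; first by rewrite gt_eqF // s0 //; exact: SS.
  apply: (@continuous_comp _ _ _ (fun q : R * R => vec3 q.1 q.2 0) sigma).
    exact: vec3_continuous.
  by apply: strip_continuous_at => //; rewrite mxE.
have cf (h : R -> R) (dh : R) (q : R * R) : is_derive q.1 1 h dh ->
    {for q, continuous (fun q : R * R => h q.1)}.
  move=> hq; apply: (@continuous_comp _ _ _ fst h); first exact: cvg_fst.
  by apply: differentiable_continuous; apply/derivable1_diffP.
apply: (@no_equal_values_at_equal_heights R (fun x => u (vec3 x 0 0))
  (fun x => sigma (vec3 x 0 0))).
- exact: within_strip_line.
- by move=> x x01; apply: s0; rewrite /strip /= mxE.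
move=> x1 x2 x101 x201 H12.
(* The curve of slope [- f / f'] through [(x1, 0)]; equal heights make it meet the axis again at
   [x2]. *)
pose phi x : R := (height x1 - height x) / 24.
have phi1 : phi x1 = 0 by rewrite /phi subrr mul0r.
have phi2 : phi x2 = 0 by rewrite /phi H12 subrr mul0r.
have dphi (x : R) : 0 < x < 1 ->
    is_derive x 1 phi (- (f x / (24 * x ^+ 2 * (1 - x)))).
  move=> x01; have dh := is_derive_height x01.
  have -> : phi = 24^-1 *: (cst (height x1) - @height R).
    by apply/funext => t; rewrite /phi !fctE /= scale_mulE mulrC.
  apply: is_derive_eq; rewrite scale_mulE; field.
  by case/andP: x01 => ? ?; rewrite !gt_eqF ?subr_gt0.
have dw (x : R) : 0 < x < 1 -> is_derive x 1 (fun t => u (vec3 t (phi t) 0)) 0.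
  move=> x01.
  have nx : \forall q \near (x, phi x), 0 < q.1 < 1.
    have : nbhs x [set` `]0, 1[%R].
      by apply: open_nbhs_nbhs; split; [exact: interval_open|rewrite /= in_itv].
    move=> /nbhs_ballP[e /= e0 H]; apply/nbhs_ballP; exists e => // q [q1 _].
    by have := H _ q1; rewrite /= in_itv.
  (* The derivative along the curve: [f / sigma - (f' / sigma) (f / f') = 0]. *)
  have E : a x (phi x) + b x (phi x) * - (f x / (24 * x ^+ 2 * (1 - x))) = 0.
    rewrite /a /b; field; case/andP: (x01) => ? ?.
    by rewrite !gt_eqF ?subr_gt0 //; apply/s0/SS.
  rewrite -[X in is_derive _ _ _ X]E.
  apply: (@is_derive_graph R (fun x y => u (vec3 x y 0)) a b).
  - by apply: (filterS _ nx) => q; exact: ua.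
  - by apply: (filterS _ nx) => q; exact: ub.
  - by apply: cvgM; [apply: (cf _ _ _ (is_derive_f _))|exact: csV].
  - apply: cvgM; last exact: csV.
    have : is_derive x 1 (fun x : R => 24 * x ^+ 2 * (1 - x))
       (24 * (2 * x - 3 * x ^+ 2)).
      have -> : (fun x : R => 24 * x ^+ 2 * (1 - x)) =
          24 *: (id ^+ 2 - id ^+ 3).
        by apply/funext => t; rewrite !fctE /= scale_mulE; ring.
      by apply: is_derive_eq; rewrite ?fctE /= !scale_mulE; ring.
    by move=> /(cf _ _ (x, phi x)).
  - exact: dphi.
(* The definition of [phi] singles out [x1]; generalizing over [phi] keeps only facts symmetric in
   [x1] and [x2]. *)
wlog x12 : x1 x2 x101 x201 H12 phi phi1 phi2 dphi dw / x1 <= x2.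
  move=> W; have [|/ltW x21] := leP x1 x2; first exact: (W _ _ _ _ _ phi).
  by apply/esym/(W _ _ _ _ _ phi).
have I (x : R) : x1 <= x <= x2 -> 0 < x < 1.
  case/andP: x101 => ? ?; case/andP: x201 => ? ?.
  by move=> /andP[? ?]; apply/andP; split; lra.
(* With zero derivative the endpoint values agree, and they are those of [u] on the axis because
   [phi] vanishes at both. *)
have [|||c _] := @MVT_segment R (fun t => u (vec3 t (phi t) 0)) (fun=> 0) x1 x2.
- by [].
- by move=> x; rewrite in_itv /= => /andP[/ltW ? /ltW ?]; apply/dw/I/andP.
- apply: derivable_within_continuous => x; rewrite in_itv /= => /I/dw.
  by case.
- by rewrite mul0r phi1 phi2 => /subr0_eq ->.
Qed.

Theorem mainTheorem4 (R : realType) :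
  [/\ (forall i : 'I_3, Ck_on 2 [set: 'rV[R]_3] (component (@j R) i)),
      (forall p : 'rV[R]_3, j p <> 0),
      (forall p : 'rV[R]_3, divergence (@j R) p = 0),
      (forall p : 'rV[R]_3, dot (j p) (curl (@j R) p) = 0) &
      ~ exists (sigma u : 'rV[R]_3 -> R),
          [/\ {within @strip R, continuous sigma},
              (forall p, strip p -> 0 < sigma p),
              C1_closed (@strip R) u &
              exists G : 'rV[R]_3 -> 'rV[R]_3,
                grad_ext (@strip R) u G /\
                forall p, strip p -> j p = sigma p *: G p]].
Proof.
split.
- by move=> i; exact/polynomial_fun_Ck/component_j_polynomial.
- exact: j_neq0.
- exact: divergence_j.
- exact: dot_j_curl_j.
- move=> [sigma [u [cs s0 [_ du _] [G [gG jG]]]]].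
  exact: no_integrating_factor cs s0 du gG jG.
Qed.
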